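(* Let $X$ be a second-countable $T_1$ topological space. If Nonempty has a winning strategy in the Choquet game $\mathsf{Ch}(X)$, then Nonempty has a stationary winning strategy in $\mathsf{Ch}(X)$.
   Context: The Choquet game $\mathsf{Ch}(X)$ on a topological space $X$ is played by two players, Empty and Nonempty, for $\omega$ rounds. On round $i$, Empty moves first, choosing a point $x_i \in X$ and an open set $U_i$ with $x_i \in U_i$ and, if $i \geq 1$, $U_i \subseteq V_{i-1}$. Then Nonempty responds with an open set $V_i$ such that $x_i \in V_i \subseteq U_i$. Empty wins the play if $\bigcap_{n<\omega} V_n = \varnothing$; otherwise Nonempty wins. A strategy for Nonempty is a function $\mathfrak{S}$ which takes a partial play ending with a move by Empty (recorded as the sequence $\langle x_j,U_j\rangle_{j\le i}$ of Empty's moves, Nonempty's moves being determined by $\mathfrak{S}$) and returns a legal open set $V_i$ for Nonempty to play. It is winning if Nonempty wins every play that follows it. A strategy $\mathfrak{S}$ is stationary if $\mathfrak{S}(\langle x_j,U_j\rangle_{j\le i}) = \mathfrak{S}(\langle x_i,U_i\rangle)$ for every partial play $\langle x_j,U_j\rangle_{j\le i}$ of Empty against $\mathfrak{S}$, i.e. each response depends only on Empty's last move. *)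

(* Defs.v *)
From mathcomp Require Import all_boot all_classical.
From mathcomp Require Export topology.

Set Implicit Arguments.
Unset Strict Implicit.
Unset Printing Implicit Defensive.

Local Open Scope classical_set_scope.

Section ChoquetGame.
Context {X : topologicalType}.

Definition empty_move : Type := (X * set X)%type.

(* Argument: the moves <x_0,U_0>, ..., <x_i,U_i> of Empty, in chronological
   order; value: V_i. Values outside the partial plays against the strategy are
   irrelevant: every definition below ignores them. *)
Definition nonempty_response : Type := seq empty_move -> set X.

(* The nonempty sequences of Empty's moves that are legal when Nonempty
   answers with S; S s is then Nonempty's last answer to s. *)
Inductive partial_play (S : nonempty_response) : seq empty_move -> Prop :=
| partial_play_first x U :
    open U -> U x -> partial_play S [:: (x, U)]
| partial_play_next s x U :
    partial_play S s -> open U -> U x -> U `<=` S s ->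
    partial_play S (rcons s (x, U)).

Definition strategy (S : nonempty_response) : Prop :=
  forall s x U, partial_play S (rcons s (x, U)) ->
    [/\ open (S (rcons s (x, U))),
        S (rcons s (x, U)) x &
        S (rcons s (x, U)) `<=` U].

Definition play (S : nonempty_response) (m : nat -> empty_move) : Prop :=
  forall n, partial_play S (mkseq m n.+1).

Definition winning_strategy (S : nonempty_response) : Prop :=
  strategy S /\
  forall m, play S m -> \bigcap_n S (mkseq m n.+1) !=set0.

Definition stationary (S : nonempty_response) : Prop :=
  forall s p, partial_play S (rcons s p) -> S (rcons s p) = S [:: p].

End ChoquetGame.

Arguments empty_move : clear implicits.
Arguments nonempty_response : clear implicits.

(* Main.v *)
(* Stationarity makes Nonempty forget the past, so the past must be recovered
   from the last move <x, U> alone.  By second countability, countably many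
   histories H_0, H_1, ... of plays against the given winning strategy S are
   enough for S to answer every point x, up to shrinking its answers.  A
   history H_i is compatible with U if Empty could legally continue H_i inside
   U.  On <x, U>, Nonempty extends every compatible H_i with i <= rank U by a
   move inside U, and plays inside all the corresponding answers of S; here
   rank U is the least index of a nonempty basic open subset of U.  Since the
   space is T1, Nonempty can also delete finitely many points so that the rank
   increases at each round, unless the answer is the isolated point x.  Hence
   every compatible history is eventually extended, and a branch of successive
   extensions is a play against S whose answers are interleaved with the sets
   played by Empty, so their intersection is nonempty. *)
Require Import Defs.
From mathcomp Require Import all_boot all_classical.
From mathcomp Require Import topology.

Set Implicit Arguments.
Unset Strict Implicit.
Unset Printing Implicit Defensive.

Local Open Scope classical_set_scope.

Lemma second_countable_seq_basis (X : topologicalType) :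
  @second_countable X ->
  exists B : nat -> set X, (forall n, open (B n)) /\
    forall x U, open U -> U x -> exists2 n, B n x & B n `<=` U.
Proof.
move=> [B /pfcard_geP[B0|[f]] [Bo Bb]].
  exists (fun=> set0); split=> [_|x U Uo Ux]; first exact: open0.
  have /Bb[A [/=]] : nbhs x U by exact: open_nbhs_nbhs.
  by rewrite B0.
exists f; split=> [n|x U Uo Ux]; first by apply: Bo; exact: funS.
have /Bb[A [/= BA Ax] AU] : nbhs x U by exact: open_nbhs_nbhs.
have [n _ fn] : range f A by exact: surj.
by exists n; rewrite fn.
Qed.

Lemma open_nbhs_bounded (X : topologicalType) (x : X)
    (P : nat -> set X -> Prop) :
  (forall i V W, V `<=` W -> P i W -> P i V) ->
  (forall i, exists V, [/\ open V, V x & P i V]) ->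
  forall n, exists V, [/\ open V, V x & forall i, (i < n)%N -> P i V].
Proof.
move=> Psub Pex; elim=> [|n [V [Vo Vx PV]]].
  by exists setT; split=> //; exact: openT.
have [W [Wo Wx PW]] := Pex n.
exists (V `&` W); split=> //; first exact: openI.
move=> i; rewrite ltnS leq_eqVlt => /predU1P[->|/PV].
  by apply: Psub PW => ? [].
by apply: Psub => ? [].
Qed.

(** Phrased through the moves that could follow [h], because the value of [S] on the empty history
    is irrelevant: this makes [[::]] compatible with every [U]. *)
Definition compatible (X : topologicalType) (S : nonempty_response X)
    (h : seq (empty_move X)) (U : set X) :=
  forall p, open p.2 -> p.2 p.1 -> p.2 `<=` U -> partial_play S (rcons h p).

(** The point of [p] need not be the one that Empty has just played; this freedom is what lets
    countably many histories serve all points. *)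
Definition extended (X : topologicalType) (S : nonempty_response X)
    (H : nat -> seq (empty_move X)) (U : set X) (i : nat) (V : set X) :=
  compatible S (H i) U ->
  exists j p, [/\ H j = rcons (H i) p, partial_play S (H j), p.2 `<=` U &
                  V `<=` S (H j)].

Lemma partial_play_rcons (X : topologicalType) (S : nonempty_response X) s p :
  partial_play S (rcons s p) -> [/\ open p.2, p.2 p.1 &
    s <> [::] -> partial_play S s /\ p.2 `<=` S s].
Proof.
move Et : (rcons s p) => t pt; case: pt Et => [x U Uo Ux|s' x U ps Uo Ux US].
  by rewrite -[RHS]/(rcons [::] _) => /rcons_inj[-> ->].
by move=> /rcons_inj[-> ->].
Qed.

Lemma compatible_nil (X : topologicalType) (S : nonempty_response X) U :
  compatible S [::] U.
Proof. by move=> [x V] /= Vo Vx _; exact: partial_play_first. Qed.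

Lemma compatible_partial_play (X : topologicalType) (S : nonempty_response X)
    h U :
  partial_play S h -> U `<=` S h -> compatible S h U.
Proof.
move=> ph US [x V] /= Vo Vx VU; apply: partial_play_next => //.
exact: subset_trans VU US.
Qed.

(** A history is coded by a finite sequence of pairs [(a, b)] of basis indices: [B a] is the open
    set of a move and [B b] a part of the answer of [S] to it. *)
Lemma countably_many_histories (X : topologicalType)
    (S : nonempty_response X) :
  @second_countable X -> strategy S ->
  exists H : nat -> seq (empty_move X), (exists i, H i = [::]) /\
    forall i x U, open U -> U x ->
      exists V, [/\ open V, V x & extended S H U i V].
Proof.
move=> /second_countable_seq_basis[B [Bo Bb]] Sstr.
(* One chosen [x'] replaces all the points [x] with the same [h], [a] and [b]. If there is no such
   [x], the default [[::]] is harmless. *)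
have /choice[next nextP] : forall q : seq (empty_move X) * (nat * nat),
    exists h, forall x, B q.2.1 x -> B q.2.2 `<=` S (rcons q.1 (x, B q.2.1)) ->
      exists x', [/\ B q.2.1 x', B q.2.2 `<=` S (rcons q.1 (x', B q.2.1)) &
                     h = rcons q.1 (x', B q.2.1)].
  move=> [h [a b]] /=.
  have [[x [Bx BS]]|nx] := pselect
    (exists x, B a x /\ B b `<=` S (rcons h (x, B a))).
    by exists (rcons h (x, B a)) => _ _ _; exists x.
  by exists [::] => x Bx BS; case: nx; exists x.
pose hist (c : seq (nat * nat)) := foldl (fun h ab => next (h, ab)) [::] c.
pose code (i : nat) : seq (nat * nat) := odflt [::] (unpickle i).
have codeK c : code (pickle c) = c by rewrite /code pickleK.
exists (fun i => hist (code i)); split.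
  by exists (pickle ([::] : seq (nat * nat))); rewrite codeK.
move=> i x U Uo Ux; rewrite /extended; move: (code i) => c.
have [comp|ncomp] := pselect (compatible S (hist c) U); last first.
  by exists U; split=> // /ncomp.
have [a Bax BaU] := Bb x U Uo Ux.
have pa x' : B a x' -> partial_play S (rcons (hist c) (x', B a)).
  by move=> Bx'; apply: comp => /=.
have [So Sx _] := Sstr _ _ _ (pa x Bax).
have [b Bbx BbS] := Bb x _ So Sx.
have [x' [Bax' BbS' nextE]] := nextP (hist c, (a, b)) x Bax BbS.
exists (B b); split=> // _; exists (pickle (rcons c (a, b))), (x', B a).
have -> : hist (code (pickle (rcons c (a, b)))) = rcons (hist c) (x', B a).
  by rewrite codeK -nextE /hist foldl_rcons.
by split=> //; exact: pa.
Qed.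

(* [i <= rank U], without reference to the least index *)
Definition below_rank (X : topologicalType) (B : nat -> set X) (U : set X)
    (i : nat) :=
  forall j, (j < i)%N -> B j !=set0 -> ~ B j `<=` U.

Definition increases_rank (X : topologicalType) (B : nat -> set X) (x : X)
    (i : nat) (V : set X) :=
  B i !=set0 -> B i `<=` V -> V `<=` [set x].

Lemma below_rank_sub (X : topologicalType) (B : nat -> set X) U V i :
  V `<=` U -> below_rank B U i -> below_rank B V i.
Proof. by move=> VU bU j /bU{}bU /bU{}bU BV; apply/bU/(subset_trans BV). Qed.

(** If [B i] has a point [y] other than [x], T1 gives a neighbourhood of [x] missing [y]. Otherwise
    [B i] is empty or equal to the then open set [[set x]]. *)
Lemma increases_rank_ex (X : topologicalType) (B : nat -> set X) :
  @accessible_space X -> (forall i, open (B i)) ->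
  forall x i, exists V, [/\ open V, V x & increases_rank B x i V].
Proof.
move=> T1 Bo x i.
have [Bx|nBx] := pselect (B i `<=` [set x]).
  have [[y By]|B0] := pselect (B i !=set0); last first.
    by exists setT; split=> //; exact: openT.
  by exists (B i); split=> //; rewrite -(Bx y By).
have [y [By yx]] : exists y, B i y /\ y <> x.
  apply: contrapT => ny; apply: nBx => y By /=.
  by apply: contrapT => yx; apply: ny; exists y.
have [|V [Vo Vx Vy]] := T1 x y; first by apply/eqP => /esym.
rewrite !inE in Vx Vy.
by exists V; split=> // _ BV; case: Vy; exact: BV.
Qed.

Definition good_answer (X : topologicalType) (S : nonempty_response X)
    (B : nat -> set X) (H : nat -> seq (empty_move X)) (p : empty_move X)
    (V : set X) :=
  [/\ open V, V p.1, V `<=` p.2 &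
      forall i, below_rank B p.2 i ->
        increases_rank B p.1 i V /\ extended S H p.2 i V].

(** Some [B n] contains the point and lies in [p.2], so only indices [i <= n] are below the rank and
    finitely many neighbourhoods are intersected. *)
Lemma good_answer_ex (X : topologicalType) (S : nonempty_response X)
    (B : nat -> set X) (H : nat -> seq (empty_move X)) (p : empty_move X) :
  @accessible_space X ->
  (forall i, open (B i)) ->
  (forall x U, open U -> U x -> exists2 n, B n x & B n `<=` U) ->
  (forall i x U, open U -> U x ->
      exists V, [/\ open V, V x & extended S H U i V]) ->
  open p.2 -> p.2 p.1 -> exists V, good_answer S B H p V.
Proof.
case: p => x U /= T1 Bo Bb Hext Uo Ux.
have [n Bnx BnU] := Bb x U Uo Ux.
have [||V [Vo Vx VP]] := @open_nbhs_bounded X x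
  (fun i V => increases_rank B x i V /\ extended S H U i V) _ _ n.+1.
- move=> i V W VW [incr ext]; split=> [B0 BV|/ext[j [p [Hj pj pU WS]]]].
    by apply: subset_trans (VW) (incr B0 _); exact: subset_trans BV VW.
  by exists j, p; split=> //; exact: subset_trans VW WS.
- move=> i; have [V [Vo Vx incr]] := increases_rank_ex T1 Bo x i.
  have [W [Wo Wx ext]] := Hext i x U Uo Ux.
  exists (V `&` W); split=> //; first exact: openI.
  split=> [B0 BVW|/ext[j [p [Hj pj pU WS]]]].
    by move=> y [Vy _]; apply: (incr B0 _ y Vy) => z /BVW[].
  by exists j, p; split=> // y [_ /WS].
exists (V `&` U); split=> //=; first exact: openI.
move=> i bU; have /VP/=[incr ext] : (i < n.+1)%N.
  rewrite ltnS leqNgt; apply/negP => /bU; apply=> //.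
  by exists x.
split=> [B0 BVU|/ext[j [p [Hj pj pU WS]]]].
  by move=> y [Vy _]; apply: (incr B0 _ y Vy) => z /BVU[].
by exists j, p; split=> // y [/WS Sy _].
Qed.

Section Run.
Context {X : topologicalType} {S : nonempty_response X} {B : nat -> set X}
  {H : nat -> seq (empty_move X)} {m : nat -> empty_move X} {V : nat -> set X}.
Hypothesis Swin : winning_strategy S.
Hypothesis H0 : exists i, H i = [::].
Hypothesis mV : forall n, good_answer S B H (m n) (V n).
Hypothesis VU : forall n, (m n.+1).2 `<=` V n.
Hypothesis mx : forall n, (m n).2 (m n).1.

Lemma run_subset i k : (i <= k)%N -> (m k).2 `<=` (m i).2.
Proof.
elim: k => [|k IH]; first by rewrite leqn0 => /eqP ->.
rewrite leq_eqVlt => /predU1P[->//|/IH{}IH].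
have [_ _ VUk _] := mV k.
exact: subset_trans (@VU k) (subset_trans VUk IH).
Qed.

(** After round [k] Empty can only repeat the point of round [k], and the sets of the earlier rounds
    contain it because the play is decreasing. *)
Lemma run_isolated k : V k `<=` [set (m k).1] -> \bigcap_n V n !=set0.
Proof.
move=> Vk; exists (m k).1 => n _.
have [_ Vn _ _] := mV n.
have [nk|kn] := ltnP n k; first by apply/VU/(run_subset nk)/mx.
have <- // : (m n).1 = (m k).1.
move: kn; rewrite leq_eqVlt => /predU1P[->//|kn].
by apply/Vk/VU/(run_subset kn)/mx.
Qed.

Lemma run_below_rank : (forall k, ~ V k `<=` [set (m k).1]) ->
  forall k, below_rank B (m k).2 k.
Proof.
move=> nV; elim=> [//|k IH] j; rewrite ltnS leq_eqVlt => /predU1P[->|jk].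
  move=> B0 BU; apply: (nV k); have [_ _ _ /(_ k IH)[incr _]] := mV k.
  by apply: incr => //; exact: subset_trans BU (@VU k).
by apply: (below_rank_sub _ IH) => //; exact: run_subset.
Qed.

(* A pair consists of the index of a history and of a round. *)
Definition extends (s t : nat * nat) :=
  exists p, [/\ H t.1 = rcons (H s.1) p, partial_play S (H t.1),
    p.2 `<=` (m s.2).2 & (s.2 < t.2)%N].

Lemma run_extends : (forall k, below_rank B (m k).2 k) ->
  forall s, compatible S (H s.1) (m s.2).2 ->
  exists2 t, extends s t & compatible S (H t.1) (m t.2).2.
Proof.
move=> rk [i k] /= comp; pose k' := maxn i k.
have sub : (m k').2 `<=` (m k).2 by apply: run_subset; exact: leq_maxr.
have [_ _ _ /(_ i)[|_ ext]] := mV k'.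
  by move=> j ji; apply: (rk k'); rewrite leq_max ji.
have [|j [p [Hj pj pU VS]]] := ext.
  by move=> q qo qx qU; apply: comp => //; exact: subset_trans qU sub.
exists (j, k'.+1); last first.
  by apply: compatible_partial_play => //=; exact: subset_trans (@VU k') VS.
exists p; split=> //=; first exact: subset_trans pU sub.
by rewrite ltnS leq_maxr.
Qed.

Lemma run_nonempty : \bigcap_n V n !=set0.
Proof.
have [[k /run_isolated//]|/forallNP nV] :=
  pselect (exists k, V k `<=` [set (m k).1]).
have rk := run_below_rank nV.
pose state := {s : nat * nat | compatible S (H s.1) (m s.2).2}.
have /choice[next nextP] : forall s : state, exists t : state,
    extends (sval s) (sval t).
  by move=> [s cs]; have [t st ct] := run_extends rk cs; exists (exist _ t ct).
have [i0 Hi0] := H0.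
have c0 : compatible S (H (i0, 0).1) (m (i0, 0).2).2.
  by rewrite /= Hi0; exact: compatible_nil.
pose f n := sval (iter n next (exist _ (i0, 0) c0 : state)).
have /choice[b bP] : forall n, exists p,
    [/\ H (f n.+1).1 = rcons (H (f n).1) p, partial_play S (H (f n.+1).1),
        p.2 `<=` (m (f n).2).2 & ((f n).2 < (f n.+1).2)%N].
  by move=> n; exact: nextP.
have Hf n : H (f n).1 = mkseq b n.
  by elim: n => [//|n IH]; have [-> _ _ _] := bP n; rewrite IH mkseqS.
have le_f n : (n <= (f n).2)%N.
  by elim: n => // n IH; have [_ _ _] := bP n; exact: leq_ltn_trans.
have bplay : play S b by move=> n; have [_ + _ _] := bP n; rewrite Hf.
have [Sstr /(_ b bplay)[y yS]] := Swin.
(* The move [b n.+1] lies in a set that Empty plays at a round after [n], hence in [V n]; and [y]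
   lies in the answer of [S] to that move. *)
exists y => n _; apply/VU/(run_subset (le_f n.+1)).
have [_ _ bU _] := bP n.+1; apply: bU.
have := yS n.+1 I; have := bplay n.+1; rewrite mkseqS.
by case: (b n.+1) => z U /Sstr[_ _ SU] /SU.
Qed.
End Run.

Theorem theorem3 (X : topologicalType)
  (X_second_countable : @second_countable X)
  (X_T1 : @accessible_space X) :
  (exists S : nonempty_response X, winning_strategy S) ->
  exists S : nonempty_response X, winning_strategy S /\ stationary S.
Proof.
move=> [S Swin].
have [B [Bo Bb]] := second_countable_seq_basis X_second_countable.
have [H [H0 Hext]] := countably_many_histories X_second_countable Swin.1.
have /choice[V VP] : forall p : empty_move X, exists V,
    open p.2 -> p.2 p.1 -> good_answer S B H p V.
  move=> p; have [[po px]|np] := pselect (open p.2 /\ p.2 p.1).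
    have [V VP] := good_answer_ex X_T1 Bo Bb Hext po px.
    by exists V.
  by exists setT => po px; case: np.
(* The value [setT] on the empty sequence is arbitrary: every partial play is nonempty. *)
pose T (s : seq (empty_move X)) := if s is p :: s' then V (last p s') else setT.
have TE s p : T (rcons s p) = V p by case: s => //= q s; rewrite last_rcons.
exists T; split; last by move=> s p _; rewrite TE.
split=> [s x U /partial_play_rcons[Uo Ux _]|m pm].
  by rewrite TE; have [] := VP (x, U) Uo Ux.
have mP n : [/\ open (m n).2, (m n).2 (m n).1 &
    mkseq m n <> [::] ->
    partial_play T (mkseq m n) /\ (m n).2 `<=` T (mkseq m n)].
  by apply: partial_play_rcons; rewrite -mkseqS.
have -> : \bigcap_n T (mkseq m n.+1) = \bigcap_n V (m n).
  by apply: eq_bigcapr => n _; rewrite mkseqS TE.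
apply: (run_nonempty Swin H0) => n.
- by have [o x _] := mP n; exact: VP.
- have [_ _ []] := mP n.+1; first by rewrite mkseqS; case: (mkseq m n).
  by rewrite mkseqS TE.
- by have [] := mP n.
Qed.
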